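(* Let $\Gamma$ be a distance-regular graph with valency $k$ and diameter $D\geq 4$. If $\Gamma$ contains a quadrangle (an induced subgraph isomorphic to the $4$-cycle), then $c_2\leq \frac{2}{D}k$. Moreover, equality $c_2=\frac{2}{D}k$ holds if and only if either $D=4$ and $\Gamma$ is a Hadamard graph, or $D\geq 5$ and $\Gamma$ is the $D$-cube.
   Context: A connected graph $\Gamma$ with diameter $D$ is distance-regular if there are integers $b_i,c_i$ ($0\le i\le D$) such that for any two vertices $x,y$ at distance $i$, exactly $c_i$ neighbours of $y$ are at distance $i-1$ from $x$ and exactly $b_i$ neighbours of $y$ are at distance $i+1$ from $x$ (with $b_D=c_0=0$). It is regular of valency $k=b_0$, and $a_i=k-b_i-c_i$. The numbers $c_i$ are intersection numbers; in particular $c_2$ is the number of common neighbours of two vertices at distance $2$. A Hadamard graph is a distance-regular graph with intersection array $\{b_0,b_1,b_2,b_3;c_1,c_2,c_3,c_4\}=\{k,k-1,\frac{k}{2},1;1,\frac{k}{2},k-1,k\}$. The $D$-cube is the graph on $\{0,1\}^D$ with two vectors adjacent iff they differ in exactly one coordinate. *)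

(* Defs.v *)
From mathcomp Require Import all_boot all_order all_algebra.

Set Implicit Arguments.
Unset Strict Implicit.
Unset Printing Implicit Defensive.

(* A graph is a finType of vertices with a Boolean adjacency relation.  A
   distance-regular graph has finite valency and finite diameter, so
   restricting to finitely many vertices loses no generality. *)
Definition simple_graph (T : finType) (e : rel T) : Prop :=
  symmetric e /\ irreflexive e.

Definition connected_graph (T : finType) (e : rel T) : Prop :=
  forall x y, connect e x y.

Definition walk (T : finType) (e : rel T) (n : nat) (x y : T) : bool :=
  [exists p : n.-tuple T, path e x p && (last x p == y)].

(* Least length of a walk from x to y.  Shortest walks have fewer than #|T|
   edges; the value is #|T| when y is not reachable from x. *)
Definition gdist (T : finType) (e : rel T) (x y : T) : nat :=
  find (fun n => walk e n x y) (iota 0 #|T|).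

Definition diameter (T : finType) (e : rel T) : nat :=
  \max_(x : T) \max_(y : T) gdist e x y.

(* For i = 0 no z satisfies (gdist e x z).+1 = i, and for i = diameter e none
   satisfies gdist e x z = i.+1, so c 0 = 0 and b (diameter e) = 0 are
   enforced.  The values of b and c beyond the diameter are irrelevant. *)
Definition distance_regular_with (T : finType) (e : rel T) (b c : nat -> nat)
    : Prop :=
  connected_graph e /\
  forall (i : nat) (x y : T), i <= diameter e -> gdist e x y = i ->
    #|[set z | e y z & (gdist e x z).+1 == i]| = c i /\
    #|[set z | e y z & gdist e x z == i.+1]| = b i.

(* bs = {b_0, ..., b_(D-1)} and cs = {c_1, ..., c_D}: the array of c starts at
   index 1, hence the leading 0 = c_0; nth returns b_D = 0 by default. *)
Definition has_intersection_array (T : finType) (e : rel T) (bs cs : seq nat)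
    : Prop :=
  [/\ size bs = diameter e, size cs = diameter e
    & distance_regular_with e (nth 0 bs) (nth 0 (0 :: cs))].

Definition hadamard_graph (T : finType) (e : rel T) : Prop :=
  exists2 k : nat, ~~ odd k &
    has_intersection_array e [:: k; k.-1; k./2; 1] [:: 1; k./2; k.-1; k].

Definition graph_iso (T U : finType) (e : rel T) (f : rel U) : Prop :=
  exists2 h : T -> U, bijective h & forall x y, f (h x) (h y) = e x y.

Definition contains_induced (T U : finType) (e : rel T) (f : rel U) : Prop :=
  exists2 h : U -> T, injective h & forall u v, e (h u) (h v) = f u v.

Definition cycle_graph (n : nat) : rel 'I_n :=
  fun i j => (j == ordS i) || (i == ordS j).

Definition contains_quadrangle (T : finType) (e : rel T) : Prop :=
  contains_induced e (@cycle_graph 4).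

Definition cube_graph (D : nat) : rel {ffun 'I_D -> bool} :=
  fun x y => #|[set i | x i != y i]| == 1.

(* Main.v *)
Require Import Defs.
From mathcomp Require Import all_boot all_order all_algebra zify ring lra.

Set Implicit Arguments.
Unset Strict Implicit.
Unset Printing Implicit Defensive.

(** Write [a_1 = k - b_1 - 1]; a quadrangle forces [c_2 >= 2].

    If [a_1 <= c_2], fix a vertex [x] and a level [j].  Two distinct vertices
    [u], [v] at distance [j] from [x] have [m] common neighbours at distance
    [j - 1] and [n] at distance [j + 1] from [x], with [m + n <= c_2].  The sums
    of [m], [n] and [m n] over all pairs [u], [v] are determined by the
    intersection numbers, so the pointwise inequalities
    [m n <= (c_2 - 1) m], [m n <= (c_2 - 1) n] and [4 m n <= c_2 (m + n)] yield
    [b_j < b_(j-1)], [c_j < c_(j+1)] and, for [2 <= j <= D - 2],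
    [(b_(j-1) - b_j) + (c_(j+1) - c_j) >= 2 c_2 - 2].  Summing over [j] gives
    [2 k >= D c_2 + (D - 4) (c_2 - 2)].  Equality leaves the Hadamard array when
    [D = 4], and [c_2 = 2], [c_i = i], [b_i = D - i] when [D >= 5]; then
    [v |-> {y ~ x | d(y, v) < d(x, v)}] is an isomorphism onto the cube.

    If [a_1 > c_2], Terwilliger's inequality
    [c_(i+1) - b_(i+1) - c_i + b_i >= a_1 + 2] telescopes to
    [2 k >= D (a_1 + 2) > D c_2].  It follows from
    [\sum_u s_i(u) (s_(i-1)(u) + s_i(u) + s_(i+1)(u)) >= 0], where [s_i(u)] is the
    alternating number of vertices of a quadrangle within distance [i] of [u]:
    every summand is nonnegative, and the sum is a positive multiple of
    [c_(i+1) - b_(i+1) - c_i + b_i - a_1 - 2]. *)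

(** * The graph metric *)

Section Distance.

Variables (T : finType) (e : rel T).
Hypotheses (e_sym : symmetric e) (e_irr : irreflexive e).
Hypothesis e_conn : connected_graph e.

Local Notation d := (gdist e).

Lemma walkP (n : nat) (x y : T) :
  reflect (exists p, [/\ size p = n, path e x p & last x p = y]) (walk e n x y).
Proof.
apply: (iffP existsP) => [[p /andP[pP /eqP pl]]|[p [sp pP pl]]].
  by exists p; rewrite size_tuple.
by exists (Tuple (introT eqP sp)); rewrite /= pP pl eqxx.
Qed.

Lemma gdist_path_le (x : T) (p : seq T) : path e x p -> d x (last x p) <= size p.
Proof.
move=> pP; rewrite leqNgt; apply/negP => lt_p.
have lt_pT : size p < #|T|.
  by rewrite (leq_trans lt_p)// /gdist (leq_trans (find_size _ _))// size_iota.
have := before_find 0 lt_p; rewrite nth_iota// add0n.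
by have -> : walk e (size p) x (last x p) by apply/walkP; exists p.
Qed.

Lemma geodesicP (x y : T) :
  exists p, [/\ path e x p, last x p = y & size p = d x y].
Proof.
have /connectP[p0 /shortenP[p pP p_uniq _] ->] := e_conn x y.
set y' := last x p.
(* A repetition-free path has fewer than [#|T|] edges, so the bounded search in [gdist] succeeds. *)
have lt_p : size p < #|T| by have := max_card [in x :: p]; rewrite (card_uniqP p_uniq).
have w_has : has (fun n => walk e n x y') (iota 0 #|T|).
  apply/hasP; exists (size p); first by rewrite mem_iota.
  by apply/walkP; exists p.
have := nth_find 0 w_has; rewrite nth_iota; last by rewrite -{2}(size_iota 0 #|T|) -has_find.
by rewrite add0n => /walkP[q [sq qP ql]]; exists q.
Qed.

Lemma gdist0 (x : T) : d x x = 0.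
Proof. by apply/eqP; rewrite -leqn0; apply: (@gdist_path_le x [::]). Qed.

Lemma gdist_eq0 (x y : T) : (d x y == 0) = (x == y).
Proof.
apply/eqP/eqP => [dxy|->]; last exact: gdist0.
by have [[|z p] [_ yl]] := geodesicP x y; rewrite dxy.
Qed.

Lemma gdist_triangle (y x z : T) : d x z <= d x y + d y z.
Proof.
have [p [pP pl <-]] := geodesicP x y; have [q [qP ql <-]] := geodesicP y z.
rewrite -size_cat -ql -pl -last_cat; apply: gdist_path_le.
by rewrite cat_path pP pl.
Qed.

Lemma gdist_sym (x y : T) : d x y = d y x.
Proof.
suff le_sym u v : d u v <= d v u by apply/eqP; rewrite eqn_leq !le_sym.
have [p [pP pl <-]] := geodesicP v u.
have := @gdist_path_le u (rev (belast v p)).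
rewrite -pl rev_path (eq_path (e' := e)) => [/(_ pP)|? ?]; last exact: e_sym.
rewrite size_rev size_belast.
by case: p {pP pl} => [|z p] //=; rewrite rev_cons last_rcons.
Qed.

Lemma gdist_eq1 (x y : T) : (d x y == 1) = e x y.
Proof.
apply/eqP/idP => [dxy|exy].
  by have [[|z [|? ?]] [zP zy]] := geodesicP x y; rewrite dxy // -zy; case/andP: zP.
apply/eqP; rewrite eqn_leq; have -> : d x y <= 1.
  by apply: (@gdist_path_le x [:: y]); rewrite /= exy.
by rewrite lt0n gdist_eq0; apply: contraTneq exy => ->; rewrite e_irr.
Qed.

Lemma adj_gdist (x y : T) : e x y -> d x y = 1.
Proof. by rewrite -gdist_eq1 => /eqP. Qed.

Lemma gdist_adj_leS (x y z : T) : e y z -> d x z <= (d x y).+1.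
Proof. by move=> /adj_gdist yz; have := gdist_triangle y x z; rewrite yz addn1. Qed.

Lemma gdist_adj (x y z : T) :
  e y z -> (d x z <= (d x y).+1) && (d x y <= (d x z).+1).
Proof. by move=> yz; rewrite !gdist_adj_leS// e_sym. Qed.

Lemma gdist_pred (x y : T) (n : nat) :
  d x y = n.+1 -> exists2 z, e z y & d x z = n.
Proof.
move=> dxy; have [p [pP pl ps]] := geodesicP x y.
case/lastP: p => [|p z] in pP pl ps *; first by rewrite dxy in ps.
move: pP pl ps; rewrite rcons_path last_rcons size_rcons dxy => /andP[pP pz] zy [ps].
subst z; exists (last x p) => //; apply/eqP; rewrite eqn_leq -{1}ps gdist_path_le//=.
by have := gdist_adj_leS x pz; rewrite dxy.
Qed.

Lemma gdist_split (x y : T) (n : nat) :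
  n <= d x y -> exists2 z, d x z = n & d z y = d x y - n.
Proof.
move: {2}(d x y - n) (erefl (d x y - n)) => m.
elim: m y => [|m IHm] y dm le_n.
  by exists y; rewrite ?gdist0; lia.
have [w wy dw] := @gdist_pred x y (d x y).-1 ltac:(lia).
have [z xz zw] := IHm w ltac:(lia) ltac:(lia).
exists z => //; apply/eqP; rewrite eqn_leq; apply/andP; split.
  by have := gdist_adj_leS z wy; lia.
by have := gdist_triangle z x y; lia.
Qed.

Lemma gdist_le_diameter (x y : T) : d x y <= diameter e.
Proof.
apply: leq_trans (leq_bigmax_cond (P := predT) x isT).
exact: (leq_bigmax_cond (P := predT) (F := d x) y isT).
Qed.

Lemma diameter_witness : 0 < diameter e -> exists x y, d x y = diameter e.
Proof.
move=> D_gt0; have T_gt0 : 0 < #|T|.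
  by rewrite lt0n; apply: contraTneq D_gt0 => /card0_eq T0; rewrite /diameter big_pred0.
have [x _ Dx] := eq_bigmax_cond (fun x => \max_y d x y) T_gt0.
have [y _ Dy] := eq_bigmax_cond (d x) T_gt0.
by exists x, y; rewrite -Dy -Dx.
Qed.

Lemma ex_gdist (i : nat) : 0 < diameter e -> i <= diameter e -> exists x y, d x y = i.
Proof.
move=> /diameter_witness[x [y dxy]]; rewrite -dxy => /gdist_split[z dxz _].
by exists x, z.
Qed.

End Distance.

(** * Counting pairs of vertices on a sphere *)

Lemma sum_indicator (T : finType) (P : pred T) : \sum_v (P v : nat) = #|[set v | P v]|.
Proof. by rewrite -sum1dep_card [RHS]big_mkcond; apply: eq_bigr => v _; case: (P v). Qed.

(** Exchange of summation: each [a] contributes the ordered pairs of distinct elements of [R a].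
    Below, [a] is a vertex under the level, a vertex above it, or a pair of both. *)
Lemma sum_distinct_pairs (A T : finType) (Q : pred A) (R : A -> pred T) :
  \sum_u \sum_(v | v != u) #|[set a | [&& Q a, R a u & R a v]]|
  = \sum_(a | Q a) #|R a| * #|R a|.-1.
Proof.
transitivity (\sum_(a | Q a) \sum_(u | R a u) \sum_(v | (v != u) && R a v) 1).
  transitivity (\sum_u \sum_(v | v != u) \sum_(a | Q a) (R a u && R a v)).
    apply: eq_bigr => u _; apply: eq_bigr => v _.
    by rewrite cardsE -sum1_card big_mkcondr.
  under eq_bigr do rewrite exchange_big.
  rewrite exchange_big; apply: eq_bigr => a _; rewrite [RHS]big_mkcond.
  apply: eq_bigr => u _; case Rau: (R a u); last by rewrite big1.
  by rewrite [RHS]big_mkcondr; apply: eq_bigr => v _; case: (R a v).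
apply: eq_bigr => a _; rewrite -sum_nat_const.
apply: eq_bigr => u Rau; rewrite (cardD1 u (R a)) [u \in _]Rau /= add0n.
by rewrite -sum1_card; apply: eq_bigl => v; rewrite !inE.
Qed.

(** * Identities between intersection numbers *)

Section DistanceRegular.

Variables (T : finType) (e : rel T) (b c : nat -> nat).
Hypotheses (e_simple : simple_graph e) (e_drg : distance_regular_with e b c).

Local Notation d := (gdist e).
Local Notation D := (diameter e).

Let e_sym : symmetric e := e_simple.1.
Let e_irr : irreflexive e := e_simple.2.
Let e_conn : connected_graph e := e_drg.1.

Lemma card_closer (x y : T) :
  #|[set z | e y z & (d x z).+1 == d x y]| = c (d x y).
Proof. exact: (e_drg.2 _ _ _ (gdist_le_diameter e x y) erefl).1. Qed.

Lemma card_farther (x y : T) :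
  #|[set z | e y z & d x z == (d x y).+1]| = b (d x y).
Proof. exact: (e_drg.2 _ _ _ (gdist_le_diameter e x y) erefl).2. Qed.

Lemma card_nbrs (y : T) : #|[set z | e y z]| = b 0.
Proof.
rewrite -(gdist0 e y) -card_farther gdist0; apply: eq_card => z.
by rewrite !inE (gdist_eq1 e_irr e_conn) andbb.
Qed.

Lemma card_nbrs_split (x y : T) :
  c (d x y) + #|[set z | e y z & d x z == d x y]| + b (d x y) = b 0.
Proof.
rewrite -(card_nbrs y) -card_closer -card_farther.
set C := [set z | _ & _.+1 == _]; set A := [set z | _ & _ == d x y].
set B := [set z | _ & _ == _.+1].
have -> : [set z | e y z] = (C :|: A) :|: B.
  apply/setP=> z; rewrite !inE; case yz: (e y z) => //=.
  by have := gdist_adj e_sym e_irr e_conn x yz; lia.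
rewrite cardsU; have -> : (C :|: A) :&: B = set0.
  by apply/setP=> z; rewrite !inE; case: (e y z) => //=; lia.
rewrite cards0 subn0 cardsU; have -> : C :&: A = set0.
  by apply/setP=> z; rewrite !inE; case: (e y z) => //=; lia.
by rewrite cards0 subn0.
Qed.

Section PositiveDiameter.

Hypothesis D_gt0 : 0 < D.

Lemma c_plus_b_le (i : nat) : i <= D -> c i + b i <= b 0.
Proof.
move=> /(ex_gdist e_irr e_conn D_gt0)[x [y <-]].
by rewrite -(card_nbrs_split x y) leq_add2r leq_addr.
Qed.

Lemma intersection_c0 : c 0 = 0.
Proof.
have [x [y dxy]] := ex_gdist e_irr e_conn D_gt0 (leq0n _).
by rewrite -dxy -card_closer dxy; apply: eq_card0 => z; rewrite !inE andbF.
Qed.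

Lemma intersection_c1 : c 1 = 1.
Proof.
have [x [y dxy]] := ex_gdist e_irr e_conn D_gt0 D_gt0.
rewrite -{1}dxy -card_closer dxy; apply: etrans (cards1 x); apply: eq_card => z.
rewrite !inE eqSS gdist_eq0 // eq_sym.
have [->|] := eqVneq z x; last by rewrite andbF.
by rewrite e_sym -(gdist_eq1 e_irr e_conn) dxy.
Qed.

Lemma intersection_bD : b D = 0.
Proof.
have [x [y dxy]] := ex_gdist e_irr e_conn D_gt0 (leqnn _).
rewrite -dxy -card_farther dxy; apply: eq_card0 => z; rewrite !inE.
by have := gdist_le_diameter e x z; case: (e y z) => //=; lia.
Qed.

Lemma b_gt0 (i : nat) : i < D -> 0 < b i.
Proof.
move=> lt_iD; have [x [y dxy]] := ex_gdist e_irr e_conn D_gt0 lt_iD.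
have [z zy dxz] := gdist_pred e_irr e_conn dxy.
by rewrite -dxz -card_farther; apply/card_gt0P; exists y; rewrite inE zy dxz dxy eqxx.
Qed.

Lemma c_gt0 (i : nat) : i < D -> 0 < c i.+1.
Proof.
move=> lt_iD; have [x [y dxy]] := ex_gdist e_irr e_conn D_gt0 lt_iD.
have [z zy dxz] := gdist_pred e_irr e_conn dxy.
by rewrite -dxy -card_closer; apply/card_gt0P; exists z; rewrite inE e_sym zy dxz dxy eqxx.
Qed.

Lemma card_common_adj (x y : T) :
  e x y -> #|[set z | e x z & e y z]| + b 1 + 1 = b 0.
Proof.
move=> xy; have dxy := adj_gdist e_irr e_conn xy.
rewrite -(card_nbrs_split x y) dxy intersection_c1 addnC addnA; congr (_ + _ + _).
by apply: eq_card => z; rewrite !inE (gdist_eq1 e_irr e_conn) andbC.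
Qed.

Lemma card_common_gdist2 (x y : T) :
  d x y = 2 -> #|[set z | e x z & e y z]| = c 2.
Proof.
move=> dxy; rewrite -dxy -card_closer dxy.
by apply: eq_card => z; rewrite !inE eqSS (gdist_eq1 e_irr e_conn) andbC.
Qed.

Lemma common_nbr_gdist (x y z : T) : e x z -> e y z -> d x y <= 2.
Proof.
move=> xz yz; have := gdist_triangle e_conn z x y.
by rewrite [d z y](gdist_sym e_sym e_conn) (adj_gdist _ _ xz) ?(adj_gdist _ _ yz).
Qed.

(** Vertices with a common neighbour are at distance 1 or 2, so they have a_1 or c_2 of them; the
    hypothesis is a_1 <= c_2. *)
Lemma card_common_le (x y : T) :
  b 0 <= (b 1 + c 2).+1 -> x != y -> #|[set z | e x z & e y z]| <= c 2.
Proof.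
move=> a1_le neq_xy; have [->|/set0Pn[z]] := eqVneq [set z | e x z & e y z] set0.
  by rewrite cards0.
rewrite inE => /andP[xz yz]; have := common_nbr_gdist xz yz.
case dxy: (d x y) => [|[|[|//]]] _.
- by move/eqP: dxy neq_xy; rewrite gdist_eq0 // => ->.
- by have := @card_common_adj x y; rewrite -(gdist_eq1 e_irr e_conn) dxy => /(_ isT); lia.
- by rewrite card_common_gdist2.
Qed.

(** Both sides count the edges between two consecutive spheres. *)
Lemma sphere_double_count (x : T) (i : nat) :
  #|[set u | d x u == i]| * b i = #|[set u | d x u == i.+1]| * c i.+1.
Proof.
rewrite -!sum_nat_const [LHS]big_mkcond [RHS]big_mkcond /=.
transitivity (\sum_u \sum_v ([&& d x u == i, d x v == i.+1 & e u v] : nat)).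
  apply: eq_bigr => u _; rewrite sum_indicator inE; case: eqP => [dxu|_] /=.
    by rewrite -dxu -card_farther; apply: eq_card => v; rewrite !inE andbC.
  by rewrite cardsE eq_card0.
rewrite exchange_big; apply: eq_bigr => v _; rewrite sum_indicator inE.
case: eqP => [dxv|_] /=; last by apply: eq_card0 => u; rewrite inE andbF.
rewrite -dxv -card_closer dxv; apply: eq_card => u.
by rewrite !inE eqSS e_sym andbC.
Qed.

Lemma sphere_gt0 (x : T) (i : nat) : i <= D -> 0 < #|[set u | d x u == i]|.
Proof.
elim: i => [|i IHi] le_iD; first by apply/card_gt0P; exists x; rewrite inE gdist0.
have := sphere_double_count x i; have := b_gt0 le_iD; have := IHi (ltnW le_iD).
by case: #|[set u | d x u == i.+1]| => //; nia.
Qed.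

(** Take [w] at distance 2 from [x] on a geodesic of length [D] from [x] to [p]. A common neighbour
    of [x] and [w] is at distance at least [D - 1] from [p], hence farther from [p] than [w]. *)
Lemma c2_le_b : 1 < D -> c 2 <= b (D - 2).
Proof.
move=> D_gt1; have [x [p dxp]] := diameter_witness D_gt0.
have [w dxw dwp] := @gdist_split _ _ e_irr e_conn x p 2 ltac:(lia).
rewrite -dxp -dwp -dxw -card_closer [d w p](gdist_sym e_sym e_conn) -card_farther.
apply/subset_leq_card/subsetP => z; rewrite !inE => /andP[wz].
rewrite wz dxw eqSS => /eqP dxz /=.
have := gdist_adj e_sym e_irr e_conn p wz; have := gdist_triangle e_conn z x p.
by rewrite [d p w](gdist_sym e_sym e_conn) [d z p](gdist_sym e_sym e_conn); lia.
Qed.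

End PositiveDiameter.

(** * The case a_1 <= c_2: growth of the intersection numbers *)

Section FewTriangles.

Hypothesis D_gt1 : 1 < D.
(* [b 0 = b 1 + a_1 + 1], so this says [a_1 <= c_2]. *)
Hypothesis a1_le_c2 : b 0 <= (b 1 + c 2).+1.
Hypothesis c2_gt1 : 1 < c 2.

Let D_gt0 : 0 < D := ltnW D_gt1.

Section Level.

Variables (x : T) (i : nat).
Let lev j u := d x u == j.
Let low (a u : T) := e a u && lev i.+1 u.

(** The level test inside [low] makes both counts vanish unless [u] and [v] lie on the sphere of
    radius [i.+1], so the sums below may range over all pairs. *)
Let mlow u v := #|[set a | [&& lev i a, low a u & low a v]]|.
Let mup u v := #|[set a | [&& lev i.+2 a, low a u & low a v]]|.
Let n1 := #|[set u | d x u == i.+1]|.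

Lemma mlow_mup_le u v : v != u -> mlow u v + mup u v <= c 2.
Proof.
move=> neq_vu; rewrite eq_sym in neq_vu.
apply: leq_trans (card_common_le D_gt0 a1_le_c2 neq_vu).
rewrite /mlow /mup -cardsUI; set S := _ :&: _; have -> : S = set0.
  by apply/setP=> a; rewrite !inE /lev; lia.
rewrite cards0 addn0; apply/subset_leq_card/subsetP => a; rewrite !inE /low.
by rewrite ![e _ a]e_sym => /orP[] /and3P[_ /andP[-> _] /andP[-> _]].
Qed.

(** Each [a] on the sphere of radius [i] has [b i] neighbours one level up; [sphere_double_count]
    then expresses the result through [n1]. *)
Lemma sum_mlow : \sum_u \sum_(v | v != u) mlow u v = n1 * c i.+1 * (b i).-1.
Proof.
rewrite sum_distinct_pairs /n1 -sphere_double_count -mulnA.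
rewrite -[RHS]sum_nat_const; apply: eq_big => [a|a /eqP da]; first by rewrite inE.
suff -> : #|low a| = b i by [].
by rewrite -da -card_farther; apply: eq_card => u; rewrite inE unfold_in /lev da.
Qed.

Lemma sum_mup : \sum_u \sum_(v | v != u) mup u v = n1 * b i.+1 * (c i.+2).-1.
Proof.
rewrite sum_distinct_pairs /n1 sphere_double_count -mulnA.
rewrite -[RHS]sum_nat_const; apply: eq_big => [a|a /eqP da]; first by rewrite inE.
suff -> : #|low a| = c i.+2 by [].
by rewrite -da -card_closer; apply: eq_card => u; rewrite inE unfold_in /lev da.
Qed.

(** The product counts pairs of a lower and an upper common neighbour. Two such vertices are at
    distance 2, and all their [c 2] common neighbours lie on the level between them. *)
Lemma sum_mlow_mup :
  \sum_u \sum_(v | v != u) mlow u v * mup u v = n1 * c i.+1 * b i.+1 * (c 2).-1.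
Proof.
pose Q (ac : T * T) := lev i ac.1 && lev i.+2 ac.2.
pose R (ac : T * T) u := low ac.1 u && low ac.2 u.
transitivity (\sum_u \sum_(v | v != u) #|[set ac | [&& Q ac, R ac u & R ac v]]|).
  apply: eq_bigr => u _; apply: eq_bigr => v _; rewrite -cardsX; apply: eq_card => -[a f].
  rewrite !inE /Q /R /=; case: (lev i a); case: (lev i.+2 f) => //=; rewrite ?andbF //.
  by case: (low a u); case: (low a v) => //=; rewrite ?andbF.
rewrite sum_distinct_pairs.
transitivity (\sum_(ac | Q ac) #|R ac| * (c 2).-1).
  apply: eq_bigr => -[a f] /andP[/= /eqP da /eqP df].
  have [->//|/card_gt0P[u]] := posnP #|R (a, f)|.
  case/andP => /andP[au _] /andP[fu _].
  suff -> : #|R (a, f)| = c 2 by [].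
  have daf : d a f = 2.
    have := common_nbr_gdist au fu; have := gdist_triangle e_conn a x f.
    by rewrite /= da df; lia.
  rewrite -(card_common_gdist2 daf); apply: eq_card => w.
  rewrite inE unfold_in /R /low /lev /=.
  case aw: (e a w) => //=; case fw: (e f w); rewrite ?andbF //=.
  have := gdist_adj e_sym e_irr e_conn x aw; have := gdist_adj e_sym e_irr e_conn x fw.
  by rewrite da df; lia.
rewrite -big_distrl /=; congr (_ * _).
(* The same incidences are now counted from the middle vertex [u], whose lower and upper neighbours
   are chosen independently. *)
transitivity (\sum_u \sum_(ac | Q ac) R ac u).
  by rewrite exchange_big; apply: eq_bigr => ac _; rewrite -sum1_card big_mkcond.
transitivity (\sum_(u in [set u | d x u == i.+1]) c i.+1 * b i.+1).
  rewrite [RHS]big_mkcond /=; apply: eq_bigr => u _; rewrite inE.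
  case: eqP => [du|du]; last by rewrite big1 // => ac _; rewrite /R /low /lev; lia.
  rewrite -du -card_closer -card_farther -cardsX -sum1_card.
  rewrite big_mkcond [RHS]big_mkcond /=; apply: eq_bigr => -[a f] _.
  rewrite !inE /= /R /Q /low /lev /= du !eqSS ![e u _]e_sym eqxx !andbT.
  by case: (d x a == i); case: (d x f == _); case: (e a u); case: (e f u).
by rewrite sum_nat_const mulnA.
Qed.

End Level.

(** If the lower count m is positive, then m + n <= c_2 bounds the upper count n by c_2 - 1; hence m
    n <= (c_2 - 1) m always. Summing and cancelling the common factors gives the claim. *)
Lemma b_decr (i : nat) : i.+1 < D -> b i.+1 < b i.
Proof.
move=> iD; have [x _] := diameter_witness D_gt0.
have n1_gt0 := sphere_gt0 D_gt0 x (ltnW iD); have c_pos := c_gt0 D_gt0 (ltnW iD).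
have b_pos := b_gt0 D_gt0 (ltnW iD).
have := sum_mlow_mup x i; have := sum_mlow x i.
set X := \sum_u _; set Y := \sum_u _ => eqX eqY.
have : Y <= X * (c 2).-1.
  rewrite /X big_distrl; apply: leq_sum => u _; rewrite big_distrl.
  apply: leq_sum => v /(mlow_mup_le x i) /=; set m := #|_|; set n := #|_| => le_c.
  by case: m le_c => // m le_c; rewrite leq_mul2l; lia.
rewrite eqX eqY leq_pmul2r; last by lia.
by rewrite leq_pmul2l; lia.
Qed.

Lemma c_incr (i : nat) : i.+1 < D -> c i.+1 < c i.+2.
Proof.
move=> iD; have [x _] := diameter_witness D_gt0.
have n1_gt0 := sphere_gt0 D_gt0 x (ltnW iD); have b_pos := b_gt0 D_gt0 iD.
have c_pos := c_gt0 D_gt0 iD.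
have := sum_mlow_mup x i; have := sum_mup x i.
set X := \sum_u _; set Y := \sum_u _ => eqX eqY.
have : Y <= X * (c 2).-1.
  rewrite /X big_distrl; apply: leq_sum => u _; rewrite big_distrl.
  apply: leq_sum => v /(mlow_mup_le x i) /=; set m := #|_|; set n := #|_| => le_c.
  by rewrite mulnC; case: n le_c => // n le_c; rewrite leq_mul2l; lia.
rewrite eqX eqY leq_pmul2r; last by lia.
by rewrite mulnAC leq_pmul2l; lia.
Qed.

Lemma level_inequality (i : nat) : i.+1 < D ->
  4 * (c i.+1 * b i.+1 * (c 2).-1)
  <= c 2 * (c i.+1 * (b i).-1 + b i.+1 * (c i.+2).-1).
Proof.
move=> iD; have [x _] := diameter_witness D_gt0.
rewrite -(leq_pmul2l (sphere_gt0 D_gt0 x (ltnW iD))).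
have := sum_mlow_mup x i; have := sum_mup x i; have := sum_mlow x i.
set X := \sum_u _; set Y := \sum_u _; set Z := \sum_u _ => eqX eqY eqZ.
have : 4 * Z <= c 2 * (X + Y).
  rewrite /X /Y /Z -big_split !big_distrr; apply: leq_sum => u _.
  rewrite -big_split !big_distrr; apply: leq_sum => v /(mlow_mup_le x i) /=.
  set m := #|_|; set n := #|_| => le_c.
  (* 4 m n <= (m + n)^2 <= c_2 (m + n). *)
  by apply: leq_trans (nat_AGM2 m n).1 _; rewrite -mulnn leq_mul2r le_c orbT.
by rewrite eqX eqY eqZ; lia.
Qed.

Lemma c2_le_c (i : nat) : i.+1 < D -> c 2 <= c i.+2.
Proof.
elim: i => [//|i IHi] iD.
by apply: leq_trans (IHi (ltnW iD)) (ltnW (c_incr iD)).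
Qed.

Lemma c2_le_b_lt (i : nat) : i.+1 < D -> c 2 <= b i.
Proof.
move=> iD; have [m Dm] : exists m, D - 2 = i + m by exists (D - 2 - i); lia.
elim: m i iD Dm => [|m IHm] i iD Dm; first by rewrite -[i]addn0 -Dm; apply: c2_le_b.
by apply: leq_trans (IHm i.+1 _ _) (ltnW (b_decr iD)); lia.
Qed.

Lemma growth (i : nat) : 0 < i -> i.+2 < D ->
  b i.+1 + c i.+1 + 2 * (c 2).-1 <= b i + c i.+2.
Proof.
case: i => [//|i] _ iD.
move: (level_inequality (ltnW iD)) (b_decr (ltnW iD)) (c_incr (ltnW iD)).
move: (c2_le_b_lt iD) (c2_le_c (ltnW (ltnW iD))) c2_gt1.
move: (b i.+1) (b i.+2) (c i.+2) (c i.+3) (c 2) => B0 B C C1 m leB leC m_gt1.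
move=> + ltB ltC.
have -> : B0.-1 = B + (B0.-1 - B) by lia.
have -> : C1.-1 = C + (C1.-1 - C) by lia.
move defx: (B0.-1 - B) => x; move defy: (C1.-1 - C) => y ineq.
(* In terms of the excesses [x] and [y] over strict monotonicity, [ineq] becomes C B (2 m - 4) <= m
   (C x + B y). Bounding [m] by [B] in the first term and by [C] in the second makes C B cancel. *)
suff : 2 * (m - 2) <= x + y by lia.
rewrite -(leq_pmul2l (m := C * B)); last by rewrite muln_gt0; lia.
have : m * (C * x) <= B * (C * x) by rewrite leq_mul2r leB orbT.
have : m * (B * y) <= C * (B * y) by rewrite leq_mul2r leC orbT.
move: m m_gt1 ineq {leB leC} => [//|[//|m]] _ /=.
by lia.
Qed.

Lemma growth_sum (n : nat) : n.+2 < D ->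
  b n.+1 + c 2 + n * (2 * (c 2).-1) <= b 1 + c n.+2.
Proof.
elim: n => [|n IHn] nD; first by rewrite addn0.
have := IHn (ltnW nD); have := @growth n.+1 isT nD; lia.
Qed.

End FewTriangles.
End DistanceRegular.

(** * Terwilliger's inequality *)

Section Quadrangle.

Variables (T : finType) (e : rel T) (b c : nat -> nat).
Hypotheses (e_simple : simple_graph e) (e_drg : distance_regular_with e b c).
Hypothesis D_gt1 : 1 < diameter e.

Local Notation d := (gdist e).
Local Notation D := (diameter e).

Let e_sym : symmetric e := e_simple.1.
Let e_irr : irreflexive e := e_simple.2.
Let e_conn : connected_graph e := e_drg.1.
Let D_gt0 : 0 < D := ltnW D_gt1.

Import Order.TTheory GRing.Theory Num.Theory.
Local Open Scope ring_scope.

Implicit Types (f g : nat -> rat) (K : T -> T -> rat).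

(* The action of the adjacency matrix on functions of the distance. *)
Definition nbr_op g (h : nat) : rat :=
  (c h)%:R * g h.-1 + ((b 0)%:R - (c h)%:R - (b h)%:R) * g h + (b h)%:R * g h.+1.

Lemma sum_nbrs g (x y : T) : \sum_(z | e x z) g (d z y) = nbr_op g (d x y).
Proof.
have sumC (P : pred T) (t : rat) :
    \sum_(z | e x z) (P z)%:R * t = #|[set z | e x z & P z]|%:R * t.
  rewrite -sum1dep_card [in RHS]big_mkcondr natr_sum big_distrl.
  by apply: eq_bigr => z _; case: (P z).
rewrite [d x y](gdist_sym e_sym e_conn); set h := d y x.
transitivity (\sum_(z | e x z) (((d y z).+1 == h)%:R * g h.-1
    + (d y z == h)%:R * g h + (d y z == h.+1)%:R * g h.+1)).
  apply: eq_bigr => z xz; rewrite [d z y](gdist_sym e_sym e_conn).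
  have := gdist_adj e_sym e_irr e_conn y xz; rewrite -/h; move: (d y z) => m hm.
  have [?|[?|?]] : m.+1 = h \/ m = h \/ m = h.+1 by lia.
  - have [-> ->] : (m == h) = false /\ (m == h.+1) = false by lia.
    have [-> ->] : m.+1 == h /\ h.-1 = m by lia.
    by rewrite /=; ring.
  - have [-> ->] : (m.+1 == h) = false /\ (m == h.+1) = false by lia.
    by subst m; rewrite eqxx /=; ring.
  - have [-> ->] : (m.+1 == h) = false /\ (m == h) = false by lia.
    by subst m; rewrite eqxx /=; ring.
rewrite !big_split !sumC (card_closer e_drg) (card_farther e_drg) /nbr_op -/h.
congr (_ + _ * _ + _).
by rewrite -(card_nbrs_split e_simple e_drg y x) !natrD -/h; ring.
Qed.

(** Membership in the Bose-Mesner algebra, with matrices written as functions of two vertices. *)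
Definition radial K := exists f, forall x y, K x y = f (d x y).

Definition conv g K (x y : T) : rat := \sum_u g (d x u) * K u y.

Lemma sum_nbrs_conv g K (x y : T) :
  \sum_(z | e x z) conv g K z y = conv (nbr_op g) K x y.
Proof.
by rewrite exchange_big; apply: eq_bigr => u _; rewrite -big_distrl sum_nbrs.
Qed.

Lemma eq_conv g g' K (x y : T) :
  (forall h, (h <= D)%N -> g h = g' h) -> conv g K x y = conv g' K x y.
Proof.
by move=> eq_g; apply: eq_bigr => u _; rewrite eq_g // gdist_le_diameter.
Qed.

Lemma radial_lin (s t : rat) K K' : radial K -> radial K' ->
  radial (fun x y => s * K x y + t * K' x y).
Proof.
move=> [f Kf] [f' Kf']; exists (fun h => s * f h + t * f' h) => x y.
by rewrite Kf Kf'.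
Qed.

Lemma radial_nbrs K : radial K -> radial (fun x y => \sum_(z | e x z) K z y).
Proof.
move=> [f Kf]; exists (nbr_op f) => x y; rewrite -sum_nbrs.
by apply: eq_bigr => z _.
Qed.

Definition delta (i h : nat) : rat := (h == i)%:R.

(** The three-term recurrence for the product of the adjacency matrix and a distance matrix. *)
Lemma nbr_op_deltaS (i h : nat) : nbr_op (delta i.+1) h =
  (c i.+2)%:R * delta i.+2 h
  + ((b 0)%:R - (c i.+1)%:R - (b i.+1)%:R) * delta i.+1 h + (b i)%:R * delta i h.
Proof.
rewrite /nbr_op /delta eqSS; have -> : (h.-1 == i.+1) = (h == i.+2) by lia.
have [->|_] := eqVneq h i.+2.
  have [-> ->] : (i.+2 == i.+1) = false /\ (i.+2 == i) = false by lia.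
  by rewrite /=; ring.
have [->|_] := eqVneq h i.+1.
  have -> : (i.+1 == i) = false by lia.
  by rewrite /=; ring.
by have [->|_] := eqVneq h i; rewrite /=; ring.
Qed.

(** Multiplication by the adjacency matrix keeps matrices radial, and the recurrence can be solved
    for its top term as long as [c i.+2] is nonzero. The induction carries two consecutive indices
    for this reason. *)
Lemma radial_conv_delta K (i : nat) : radial K -> radial (conv (delta i) K).
Proof.
move=> radK; suff [] : radial (conv (delta i) K) /\ radial (conv (delta i.+1) K) by [].
elim: i => [|i [IH0 IH1]].
  have rad0 : radial (conv (delta 0) K).
    have [f Kf] := radK; exists f => x y; rewrite -Kf /conv (bigD1 x) //= big1 => [|u].
      by rewrite /delta gdist0 mul1r addr0.
    by rewrite eq_sym -(gdist_eq0 e_conn) /delta => /negPf ->; rewrite mul0r.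
  split=> //; have [f nf] := radial_nbrs rad0; exists f => x y; rewrite -nf sum_nbrs_conv.
  (* [c 0 = 0] cancels the spurious term coming from [0.-1 = 0], and [c 1 = 1] normalises the
     product to [delta 1]. *)
  apply: eq_conv => -[|[|h]] _; rewrite /nbr_op /delta /=.
  - by rewrite (intersection_c0 e_simple e_drg D_gt0); ring.
  - by rewrite (intersection_c1 e_simple e_drg D_gt0); ring.
  - by ring.
split=> //; have [le_Di|lt_iD] := leqP D i.+1.
  exists (fun=> 0) => x y; apply: big1 => u _; rewrite /delta.
  case: eqP => [dxu|_]; last by rewrite mul0r.
  by have := gdist_le_diameter e x u; rewrite dxu; lia.
have c_neq0 : (c i.+2)%:R != 0 :> rat.
  by rewrite pnatr_eq0 -lt0n; apply: (c_gt0 e_simple e_drg).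
pose s := (c i.+2)%:R^-1 : rat; pose a := (b 0)%:R - (c i.+1)%:R - (b i.+1)%:R : rat.
have [f Ef] := radial_lin s (- s) (radial_nbrs IH1) (radial_lin a (b i)%:R IH1 IH0).
exists f => x y; rewrite -Ef sum_nbrs_conv /conv !big_distrr -!big_split.
rewrite big_distrr -big_split; apply: eq_bigr => u _ /=; rewrite nbr_op_deltaS -/a.
by rewrite /s; field.
Qed.

Lemma radial_conv g K : radial K -> radial (conv g K).
Proof.
move=> radK; suff [f Ef] : radial (conv (fun h => g h * (h < D.+1)%:R) K).
  by exists f => x y; rewrite -Ef; apply: eq_conv => h le_hD; rewrite ltnS le_hD mulr1.
elim: (D.+1) => [|n IHn].
  by exists (fun=> 0) => x y; apply: big1 => u _; rewrite mulr0 mul0r.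
have [f Ef] := radial_lin 1 (g n) IHn (radial_conv_delta n radK).
exists f => x y; rewrite -Ef /conv !big_distrr -big_split; apply: eq_bigr => u _ /=.
rewrite /delta; have [->|ne] := eqVneq (d x u) n; first by rewrite ltnn ltnSn /=; ring.
have -> : (d x u < n.+1)%N = (d x u < n)%N by lia.
by rewrite /=; ring.
Qed.

Local Notation nsph x i := (#|[set u | d x u == i]|).

Lemma conv_delta_diag f (i : nat) (x : T) :
  conv (delta i) (fun u y => f (d u y)) x x = (nsph x i)%:R * f i.
Proof.
rewrite -sum1dep_card natr_sum big_distrl [RHS]big_mkcond; apply: eq_bigr => u _ /=.
rewrite /delta [d u x](gdist_sym e_sym e_conn).
by case: eqP => [->|_]; rewrite ?mul0r.
Qed.

(** The convolution is radial, so its value at an adjacent pair is the average over the neighbours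
    of [y]; the recurrence turns that sum into three diagonal values. *)
Lemma conv_delta_adj f (i : nat) (x y : T) : e x y ->
  (b 0)%:R * conv (delta i.+1) (fun u y => f (d u y)) x y
  = (nsph y i.+1)%:R * nbr_op f i.+1.
Proof.
move=> xy; pose K u y := f (d u y).
have [r Er] : radial (conv (delta i.+1) K) by apply: radial_conv; exists f.
have n0 := sphere_double_count e_simple e_drg y i.
have n1 := sphere_double_count e_simple e_drg y i.+1.
have : \sum_(z | e y z) conv (delta i.+1) K z y = (b 0)%:R * r 1%N.
  rewrite -(card_nbrs e_simple e_drg y) -sum1dep_card natr_sum big_distrl.
  apply: eq_bigr => z yz; rewrite Er (gdist_sym e_sym e_conn).
  by rewrite (adj_gdist e_irr e_conn yz) /=; ring.
rewrite sum_nbrs_conv Er (adj_gdist e_irr e_conn xy) => <-.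
transitivity ((c i.+2)%:R * conv (delta i.+2) K y y
  + ((b 0)%:R - (c i.+1)%:R - (b i.+1)%:R) * conv (delta i.+1) K y y
  + (b i)%:R * conv (delta i) K y y).
  rewrite /conv !big_distrr -!big_split; apply: eq_bigr => u _ /=.
  by rewrite nbr_op_deltaS; ring.
rewrite !conv_delta_diag /nbr_op !mulrA -!natrM.
rewrite [(c i.+2 * _)%N]mulnC -n1 [(b i * _)%N]mulnC n0 !natrM /=; ring.
Qed.

(** * One step of Terwilliger's inequality *)

Section TerwilligerStep.

Variables (p q r s : T) (j : nat).
Hypotheses (pq : e p q) (qr : e q r) (rs : e r s) (sp : e s p).
Hypotheses (dpr : d p r = 2%N) (dqs : d q s = 2%N).
Hypothesis jD : (j.+1 < D)%N.

Let i := j.+1.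
(** The alternating sum of [ball] over the quadrangle is s_i(u), and that of [shell] is s_(i-1)(u) +
    s_i(u) + s_(i+1)(u). *)
Let ball (h : nat) : rat := (h <= i)%:R.
Let shell (h : nat) : rat := (h < i)%:R + (h <= i)%:R + (h <= i.+1)%:R.
Let K u y := shell (d u y).
Let W := conv ball K.

Lemma ball_shell_class (h : nat) :
  [\/ (h < i)%N /\ (ball h = 1 /\ shell h = 3), h = i /\ (ball h = 1 /\ shell h = 2),
      h = i.+1 /\ (ball h = 0 /\ shell h = 1) | (h > i.+1)%N /\ (ball h = 0 /\ shell h = 0)].
Proof.
rewrite /ball /shell.
have [lt_hi|[hi|[hi|gt_hi]]] : (h < i)%N \/ h = i \/ h = i.+1 \/ (h > i.+1)%N by lia.
- apply: Or41; have [-> ->] : (h <= i)%N /\ (h <= i.+1)%N by lia.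
  by rewrite lt_hi /=; split=> //; split; lra.
- by apply: Or42; rewrite hi ltnn leqnn leqnSn /=; split=> //; split; lra.
- apply: Or43; have [-> ->] : (h < i)%N = false /\ (h <= i)%N = false by lia.
  by rewrite hi leqnn /=; split=> //; split; lra.
- apply: Or44; have [-> [-> ->]] : (h < i)%N = false /\ (h <= i)%N = false
    /\ (h <= i.+1)%N = false by lia.
  by rewrite /=; split=> //; split; lra.
Qed.

(** Only the position of each distance relative to [i] and [i.+1] matters, and cyclically
    consecutive distances differ by at most one, which leaves a finite check. *)
Lemma ball_shell_quad_ge0 (hp hq hr hs : nat) :
  (hp <= hq.+1)%N && (hq <= hp.+1)%N -> (hq <= hr.+1)%N && (hr <= hq.+1)%N ->
  (hr <= hs.+1)%N && (hs <= hr.+1)%N -> (hs <= hp.+1)%N && (hp <= hs.+1)%N ->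
  0 <= (ball hp - ball hq + ball hr - ball hs)
       * (shell hp - shell hq + shell hr - shell hs).
Proof.
move=> Hpq Hqr Hrs Hsp.
case: (ball_shell_class hp) => -[Cp [-> ->]];
case: (ball_shell_class hq) => -[Cq [-> ->]]; try (exfalso; lia);
case: (ball_shell_class hr) => -[Cr [-> ->]]; try (exfalso; lia);
case: (ball_shell_class hs) => -[Cs [-> ->]]; try (exfalso; lia); lra.
Qed.

(** Evaluate the form of [W] at the vector p - q + r - s: four diagonal, eight adjacent and four
    opposite entries appear. *)
Lemma quad_sum_ge0 (f : nat -> rat) :
  (forall x y, W x y = f (d x y)) -> 0 <= f 0 - 2 * f 1%N + f 2%N.
Proof.
move=> Wf; have dS := gdist_sym e_sym e_conn; have d1 := adj_gdist e_irr e_conn.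
suff : 0 <= 4 * (f 0 - 2 * f 1%N + f 2%N) by rewrite pmulr_rge0.
have -> : 4 * (f 0 - 2 * f 1%N + f 2%N) =
    (W p p - W p q + W p r - W p s) - (W q p - W q q + W q r - W q s)
  + (W r p - W r q + W r r - W r s) - (W s p - W s q + W s r - W s s).
  rewrite !Wf !gdist0 [d q p]dS [d r p]dS [d r q]dS [d s q]dS [d s r]dS [d p s]dS.
  by rewrite (d1 _ _ pq) (d1 _ _ qr) (d1 _ _ rs) (d1 _ _ sp) dpr dqs; ring.
rewrite /W /conv -!(sumrN, big_split) /=; apply: sumr_ge0 => u _.
have a1 := gdist_adj e_sym e_irr e_conn u.
have := @ball_shell_quad_ge0 (d u p) (d u q) (d u r) (d u s).
move=> /(_ ltac:(by rewrite andbC a1) ltac:(by rewrite andbC a1)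
           ltac:(by rewrite andbC a1) ltac:(by rewrite andbC a1)).
rewrite /K [d p u]dS [d q u]dS [d r u]dS [d s u]dS => /le_trans; apply.
by rewrite le_eqVlt; apply/orP; left; apply/eqP; ring.
Qed.

(** Corrections occur only at the boundary: from distance [i], [b i] neighbours leave the ball; from
    distance [i.+1], [c i.+1] enter it. *)
Lemma nbr_op_ball (h : nat) : nbr_op ball h =
  (b 0)%:R * ball h - (b i)%:R * delta i h + (c i.+1)%:R * delta i.+1 h.
Proof.
rewrite /nbr_op /ball /delta; have [->|ne1] := eqVneq h i.
  have [-> [-> [-> ->]]] : (i.-1 <= i)%N /\ (i <= i)%N /\ (i.+1 <= i)%N = false
    /\ (i == i.+1) = false by lia.
  by rewrite /=; ring.
have [->|ne2] := eqVneq h i.+1.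
  have [-> [-> ->]] : (i.+1.-1 <= i)%N /\ (i.+1 <= i)%N = false
    /\ (i.+2 <= i)%N = false by lia.
  by rewrite /=; ring.
have [lt_hi|le_ih] := ltnP h i.
  have [-> ->] : (h.-1 <= i)%N /\ (h <= i)%N by lia.
  by rewrite /=; ring.
have [-> ->] : (h.-1 <= i)%N = false /\ (h <= i)%N = false by lia.
by rewrite /=; ring.
Qed.

Lemma sum_nbrs_W (x y : T) : \sum_(z | e x z) W z y =
  (b 0)%:R * W x y - (b i)%:R * conv (delta i) K x y
  + (c i.+1)%:R * conv (delta i.+1) K x y.
Proof.
rewrite sum_nbrs_conv /W /conv !big_distrr -sumrN -!big_split /=.
by apply: eq_bigr => u _; rewrite nbr_op_ball; ring.
Qed.

Lemma shell_values : [/\ shell j = 3, shell i = 2, shell i.+1 = 1 & shell i.+2 = 0].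
Proof.
split; [case: (ball_shell_class j) | case: (ball_shell_class i) |
  case: (ball_shell_class i.+1) | case: (ball_shell_class i.+2)] => -[C [_ E]] //;
  by move: C; rewrite /i; lia.
Qed.

Lemma terwilliger_step :
  (b 0 + 1 + c i + b i.+1 <= c i.+1 + b i + b 1)%N.
Proof.
have [f Wf] : radial W by apply: radial_conv; exists shell.
have sumf x y : \sum_(z | e x z) W z y = nbr_op f (d x y).
  by rewrite -sum_nbrs; apply: eq_bigr => z _; rewrite Wf.
have dpq := adj_gdist e_irr e_conn pq; have f_ge0 := quad_sum_ge0 Wf.
have [sj si si1 si2] := shell_values.
have eq0 := sum_nbrs_W q q; have eq1 := sum_nbrs_W p q.
have := conv_delta_adj shell j pq; have := conv_delta_adj shell j.+1 pq.
rewrite -/i /nbr_op /= sj si si1 si2 => S1 S0.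
move: eq0 eq1; rewrite !sumf !conv_delta_diag !Wf gdist0 dpq /nbr_op /= si si1.
rewrite (intersection_c0 e_simple e_drg D_gt0) (intersection_c1 e_simple e_drg D_gt0).
have : (nsph q i)%:R * (b i)%:R = (nsph q i.+1)%:R * (c i.+1)%:R :> rat.
  by rewrite -!natrM (sphere_double_count e_simple e_drg).
have n_gt0 : 0 < (nsph q i)%:R :> rat.
  by rewrite ltr0n (sphere_gt0 e_simple e_drg) // ltnW.
have b_pos : 0 < (b i)%:R :> rat by rewrite ltr0n (b_gt0 e_simple e_drg).
move=> H2 H3 H4; rewrite -/K in S0 S1.
rewrite -(ler_nat rat) !natrD; move: S0 S1 H2 H3 H4 n_gt0 b_pos f_ge0.
move: (conv (delta i) K p q) (conv (delta i.+1) K p q) (f 0) (f 1%N) (f 2%N) => S0 S1 f0 f1 f2.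
move: (nsph q i)%:R (nsph q i.+1)%:R => n n1.
move: ((b 0)%:R) (ler0n rat (b 0)) ((b 1)%:R) (ler0n rat (b 1)) => k k_ge0 b1 b1_ge0.
move: ((c i)%:R) ((b i)%:R) ((c i.+1)%:R) ((b i.+1)%:R) => ci bi cI bI.
move=> H0 H1 H2 H3 H4 n_gt0 b_pos f_ge0.
(* [H3] and [H2] give k (f0 - f1) = n bi. Insert this in [k] times [H4] and replace k S0 and k S1 by
   means of [H0] and [H1]. *)
have key : k * b1 * (f0 - 2 * f1 + f2) = n * bi * (cI - ci + bi - bI - k - 1 + b1).
  have E0 := congr1 ( *%R bi) H0; have E1 := congr1 ( *%R cI) H1.
  have E2 := congr1 ( *%R (b1 - 1 - (k + cI - bI))) H2.
  have E3 := congr1 ( *%R (b1 - 1)) H3; have E4 := congr1 ( *%R k) H4.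
  by lra.
have : 0 <= n * bi * (cI - ci + bi - bI - k - 1 + b1) by rewrite -key !mulr_ge0.
by rewrite pmulr_rge0 ?mulr_gt0 //; lra.
Qed.

End TerwilligerStep.

(** The factor [b 0 - b 1 + 1] is a_1 + 2; the steps telescope from index 1, where equality
    holds. *)
Lemma terwilliger_sum (p q r s : T) (n : nat) :
  e p q -> e q r -> e r s -> e s p -> d p r = 2%N -> d q s = 2%N ->
  (n < D)%N -> (b n.+1 + n.+1 * (b 0 - b 1 + 1) <= b 0 + c n.+1)%N.
Proof.
move=> pq qr rs sp dpr dqs; have := c_plus_b_le e_simple e_drg D_gt0 D_gt0.
rewrite (intersection_c1 e_simple e_drg D_gt0) => le_b; elim: n => [|n IHn] nD.
  by rewrite (intersection_c1 e_simple e_drg D_gt0); lia.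
by have := IHn (ltnW nD); have := terwilliger_step pq qr rs sp dpr dqs nD; lia.
Qed.

Lemma terwilliger_bound (p q r s : T) :
  e p q -> e q r -> e r s -> e s p -> d p r = 2%N -> d q s = 2%N ->
  (D * (b 0 - b 1 + 1) <= 2 * b 0)%N.
Proof.
move=> pq qr rs sp dpr dqs.
have := @terwilliger_sum p q r s D.-1 pq qr rs sp dpr dqs; rewrite prednK // leqnn => /(_ isT).
by have := c_plus_b_le e_simple e_drg D_gt0 (leqnn _); lia.
Qed.

End Quadrangle.

(** * Recognising the cube *)

Section Cube.

Variables (T : finType) (e : rel T) (b c : nat -> nat).
Hypotheses (e_simple : simple_graph e) (e_drg : distance_regular_with e b c).
Hypothesis D_gt1 : 1 < diameter e.

Local Notation d := (gdist e).
Local Notation D := (diameter e).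

Hypothesis c_id : forall i, i <= D -> c i = i.
Hypothesis b_id : forall i, i <= D -> b i = D - i.

Let e_sym : symmetric e := e_simple.1.
Let e_irr : irreflexive e := e_simple.2.
Let e_conn : connected_graph e := e_drg.1.
Let D_gt0 : 0 < D := ltnW D_gt1.
Let dS := gdist_sym e_sym e_conn.

(** c_i + b_i = D = k forces a_i = 0. *)
Lemma adj_gdist_neq (x v w : T) : e v w -> d x w != d x v.
Proof.
move=> vw; apply/negP => eq_d; have := card_nbrs_split e_simple e_drg x v.
have le_D := gdist_le_diameter e x v.
rewrite (c_id le_D) (b_id le_D) (b_id (leq0n _)) subn0.
suff : 0 < #|[set z | e v z & d x z == d x v]| by lia.
by apply/card_gt0P; exists w; rewrite inE vw.
Qed.

Section Labelling.

Variables (x0 : T) (y : 'I_D -> T).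
Hypotheses (y_inj : injective y) (y_nbr : forall i, e x0 (y i)).
Hypothesis y_onto : forall z, e x0 z -> exists i, z = y i.

(** In a cube with origin [x0] this is the support of [v]: the directions in which a geodesic from
    [x0] to [v] can start. *)
Definition coords (v : T) : {set 'I_D} := [set i | (d (y i) v).+1 == d x0 v].

Lemma card_coords (v : T) : #|coords v| = d x0 v.
Proof.
rewrite -(card_imset _ y_inj) dS -(c_id (gdist_le_diameter e v x0)) -(card_closer e_drg).
apply: eq_card => z; apply/imsetP/idP => [[i]|].
  by rewrite !inE dS [d x0 v]dS => ? ->; rewrite y_nbr.
rewrite inE => /andP[/y_onto[i ->] iv]; exists i => //.
by rewrite inE dS [d x0 v]dS.
Qed.

Lemma coords_sub (v w : T) : e v w -> d x0 w = (d x0 v).+1 -> coords v \subset coords w.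
Proof.
move=> vw dw; apply/subsetP => i; rewrite !inE dw eqSS => /eqP iv.
have := gdist_triangle e_conn (y i) x0 w; rewrite (adj_gdist e_irr e_conn (y_nbr i)) dw.
by have := gdist_adj e_sym e_irr e_conn (y i) vw; lia.
Qed.

(** More neighbours of [v] are closer to [x0] than are closer to [y i], by the values of [c]. A
    neighbour of the first kind only loses [i], and by cardinality nothing else. *)
Lemma coords_down (v : T) (i : 'I_D) : i \in coords v ->
  exists2 w, e v w & coords w = coords v :\ i.
Proof.
move=> iv; have := iv; rewrite inE => /eqP dyi.
have [w] : exists w, w \in [set w | e v w & (d x0 w).+1 == d x0 v]
    :\: [set w | e v w & (d (y i) w).+1 == d (y i) v].
  apply/set0Pn; rewrite -card_gt0 cardsD.
  apply: leq_trans (leq_sub2l _ (subset_leq_card (subsetIr _ _))).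
  rewrite !(card_closer e_drg) !c_id ?gdist_le_diameter // -dyi.
  by lia.
rewrite !inE => /andP[nyw /andP[vw /eqP dw]]; exists w => //.
apply/eqP; rewrite eqEcard [#|_ :\ i|]cardsDS ?sub1set // cards1.
rewrite !card_coords -dw subn1 leqnn andbT.
rewrite subsetD1 coords_sub ?dw // 1?e_sym // inE /=.
by move: nyw; rewrite vw /=; apply: contraNN => /eqP; lia.
Qed.

(** Induction on the distance to [x0]. If v and w had equal coordinates, deleting i or j from them
    would lead to the same vertices v1 and v2, which also share a neighbour t1 lacking both. Then v,
    w, t1 would be three common neighbours, against c_2 = 2. *)
Lemma coords_inj : injective coords.
Proof.
suff inj_n n : forall v w, d x0 v <= n -> coords v = coords w -> v = w.
  by move=> v w; apply: inj_n (leqnn _).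
elim: n => [|n IHn] v w le_n eq_vw; have dvw : d x0 w = d x0 v by rewrite -!card_coords eq_vw.
  have : x0 == v by rewrite -(gdist_eq0 e_conn); lia.
  have : x0 == w by rewrite -(gdist_eq0 e_conn); lia.
  by move=> /eqP <- /eqP <-.
have [le_v|gt_v] := leqP (d x0 v) n; first exact: IHn.
have [i iv] : exists i, i \in coords v by apply/set0Pn; rewrite -card_gt0 card_coords; lia.
have [j_none|[j jv]] : coords v :\ i = set0 \/ exists j, j \in coords v :\ i.
- by have [->|/set0Pn] := eqVneq (coords v :\ i) set0; [left | right].
- have : #|coords v :\ i| = 0 by rewrite j_none cards0.
  rewrite cardsDS ?sub1set // cards1 card_coords => dv1.
  (* With a single coordinate the vertex is adjacent to [x0], hence equal to [y i]. *)
  have yE u : coords u = coords v -> y i = u.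
    move=> eq_u; have : i \in coords u by rewrite eq_u.
    have du : d x0 u = d x0 v by rewrite -!card_coords eq_u.
    by rewrite inE => di; apply/eqP; rewrite -(gdist_eq0 e_conn); lia.
  by rewrite -(yE v) // -(yE w).
have [j_neq j_in] := setD1P jv.
have [v1 vv1 S1] := coords_down iv; have [v2 vv2 S2] := coords_down j_in.
have [w1 ww1 R1] : exists2 w1, e w w1 & coords w1 = coords w :\ i.
  by apply: coords_down; rewrite -eq_vw.
have [w2 ww2 R2] : exists2 w2, e w w2 & coords w2 = coords w :\ j.
  by apply: coords_down; rewrite -eq_vw.
have lev_D1 u k : k \in coords v -> coords u = coords v :\ k -> (d x0 u).+1 = d x0 v.
  move=> kv Eu; rewrite -!card_coords Eu cardsDS ?sub1set // cards1 subn1 prednK //.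
  by rewrite card_coords; lia.
have d1 := lev_D1 _ _ iv S1; have d2 := lev_D1 _ _ j_in S2.
have w1E : w1 = v1 by symmetry; apply: IHn; [lia | rewrite S1 R1 eq_vw].
have w2E : w2 = v2 by symmetry; apply: IHn; [lia | rewrite S2 R2 eq_vw].
subst w1 w2.
have [t1 vt1 Q1] : exists2 t, e v1 t & coords t = coords v1 :\ j.
  by apply: coords_down; rewrite S1.
have [t2 vt2 Q2] : exists2 t, e v2 t & coords t = coords v2 :\ i.
  by apply: coords_down; rewrite S2 in_setD1 iv andbT eq_sym.
have dt1 : (d x0 t1).+1 = d x0 v1.
  rewrite -!card_coords Q1 cardsDS ?sub1set ?S1 // cards1 subn1 prednK //.
  by apply/card_gt0P; exists j.
have lt_t1 : d x0 t1 < d x0 v by rewrite -d1 -dt1 ltnW.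
have t2E : t2 = t1.
  by symmetry; apply: IHn; [lia | rewrite Q1 Q2 S1 S2 !setDDl setUC].
subst t2.
have neq12 : v1 != v2.
  by apply: contraTneq jv => eq12; rewrite -S1 eq12 S2 in_setD1 eqxx.
have d12 : d v1 v2 = 2.
  have := common_nbr_gdist e_simple e_drg vt1 vt2; move: neq12; rewrite -(gdist_eq0 e_conn).
  case d12: (d v1 v2) => [|[|[|]]] // _ _.
  have /(adj_gdist_neq x0) : e v1 v2 by rewrite -(gdist_eq1 e_irr e_conn) d12.
  by lia.
apply/eqP/negPn/negP => neq_vw.
have := card_common_gdist2 e_simple e_drg d12; rewrite c_id // => card2.
suff : #|[set v; w; t1]| <= 2.
  rewrite !cardsU !cards1 (_ : [set v] :&: [set w] = set0); last first.
    by apply/setP => z; rewrite !inE; apply/negP => /andP[/eqP-> /eqP]; apply/eqP.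
  rewrite cards0 (_ : _ :&: _ = set0) ?cards0 //; apply/setP => z; rewrite !inE.
  by apply/negP => /andP[/orP[] /eqP -> /eqP zt]; move: lt_t1; rewrite -zt ?dvw ltnn.
rewrite -card2; apply/subset_leq_card/subsetP => z; rewrite !inE.
case/orP => [/orP[] |] /eqP ->; last by rewrite vt1 vt2.
  by rewrite ![e _ v]e_sym vv1 vv2.
by rewrite ![e _ w]e_sym ww1 ww2.
Qed.

(** A vertex at distance [D] has all coordinates, and [coords_down] deletes them one at a time. *)
Lemma coords_surj (R : {set 'I_D}) : exists v, coords v = R.
Proof.
move: {2}(#|~: R|) (erefl #|~: R|) => n; elim: n R => [|n IHn] R cardR.
  have /card_gt0P[v] := sphere_gt0 e_simple e_drg D_gt0 x0 (leqnn D).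
  rewrite inE => /eqP dv; exists v; apply/eqP; move/eqP: cardR; rewrite cards_eq0.
  rewrite -[set0]setCT (inj_eq (@setC_inj _)) => /eqP ->.
  by rewrite eqEcard subsetT card_coords dv cardsT card_ord leqnn.
have /card_gt0P[i] : 0 < #|~: R| by rewrite cardR.
rewrite inE => iR; have [|v Sv] := IHn (i |: R).
  by rewrite setCU setIC -setDE cardsDS ?sub1set ?inE // cards1 cardR subn1.
have [|w _ Sw] := @coords_down v i; first by rewrite Sv setU11.
by exists w; rewrite Sw Sv setU1K.
Qed.

Definition label (v : T) : {ffun 'I_D -> bool} := [ffun i => i \in coords v].

Lemma label_bij : bijective label.
Proof.
have label_inj : injective label.
  move=> v w /ffunP eq_l; apply: coords_inj; apply/setP => i.
  by have := eq_l i; rewrite !ffunE.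
apply: inj_card_bij label_inj _.
have : {subset predT <= codom label}.
  move=> f _; have [v Sv] := coords_surj [set i | f i]; apply/codomP; exists v.
  by apply/ffunP => i; rewrite ffunE Sv inE.
move=> /subsetP/subset_leq_card/leq_trans; apply; exact: leq_image_card.
Qed.

(** If the labels differ in one place, [coords_down] gives a neighbour with the smaller label, and
    injectivity identifies it. Conversely, adjacent vertices are on consecutive spheres, so their
    coordinate sets are nested with one element between. *)
Lemma label_adj (v w : T) : cube_graph (label v) (label w) = e v w.
Proof.
have -> : cube_graph (label v) (label w)
    = (#|(coords v :\: coords w) :|: (coords w :\: coords v)| == 1).
  rewrite /cube_graph; congr (_ == 1); apply: eq_card => i.
  rewrite in_setU !in_setD inE !ffunE.
  by case: (i \in coords v); case: (i \in coords w).
apply/cards1P/idP => [[i Ei]|vw].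
  have half u1 u2 : (coords u1 :\: coords u2) :|: (coords u2 :\: coords u1) = [set i] ->
      i \in coords u1 -> e u1 u2.
    move=> E iu1; have [u u1u Su] := coords_down iu1; suff -> : u2 = u by [].
    apply: coords_inj; rewrite Su; apply/setP => k; have /setP/(_ k) := E.
    rewrite in_setU !in_setD !in_set1.
    have [->|_] := eqVneq k i; first by rewrite iu1; case: (i \in coords u2).
    by case: (k \in coords u1); case: (k \in coords u2).
  have : i \in [set i] by rewrite inE.
  rewrite -Ei in_setU !in_setD => /orP[] /andP[_ iu]; first exact: half iu.
  by rewrite e_sym; apply: half iu; rewrite setUC.
have half u1 u2 : e u1 u2 -> d x0 u2 = (d x0 u1).+1 ->
    exists i, (coords u1 :\: coords u2) :|: (coords u2 :\: coords u1) = [set i].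
  move=> u12 du; have sub := coords_sub u12 du.
  move: (sub); rewrite -setD_eq0 => /eqP ->; rewrite set0U; apply/cards1P.
  by rewrite cardsDS // !card_coords du subSnn.
have := gdist_adj e_sym e_irr e_conn x0 vw; have := adj_gdist_neq x0 vw => ne le.
have [|] : d x0 w = (d x0 v).+1 \/ d x0 v = (d x0 w).+1 by lia.
  exact: half.
by rewrite setUC; apply: half; rewrite e_sym.
Qed.

End Labelling.

Lemma iso_cube : graph_iso e (@cube_graph D).
Proof.
have [x0 _] := diameter_witness D_gt0.
have cardN : #|[set z | e x0 z]| = D by rewrite (card_nbrs e_simple e_drg) b_id ?subn0.
pose y (i : 'I_D) := enum_val (cast_ord (esym cardN) i).
have y_inj : injective y by move=> i j /enum_val_inj/cast_ord_inj.
have y_nbr i : e x0 (y i) by have := enum_valP (cast_ord (esym cardN) i); rewrite inE.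
have y_onto z : e x0 z -> exists i, z = y i.
  move=> x0z; have zN : z \in [set z | e x0 z] by rewrite inE.
  exists (cast_ord cardN (enum_rank_in zN z)).
  by rewrite /y cast_ordK enum_rankK_in.
exists (label x0 y); first exact: label_bij.
by move=> v w; apply: label_adj.
Qed.

End Cube.

(** * The bound and its equality case *)

Lemma card_cube_nbrs (n : nat) (f : {ffun 'I_n -> bool}) :
  #|[set g | cube_graph f g]| = n.
Proof.
pose flip i : {ffun 'I_n -> bool} := [ffun j => f j (+) (j == i)].
have flip_inj : injective flip.
  move=> i j /ffunP/(_ i); rewrite !ffunE eqxx addbC [RHS]addbC => /addIb.
  by case: eqP.
rewrite -[RHS]card_ord -cardsT -(card_imset _ flip_inj); apply: eq_card => g.
rewrite inE; apply/cards1P/imsetP => [[i /setP Ei]|[i _ ->]].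
  exists i => //; apply/ffunP => j; have := Ei j; rewrite !inE ffunE.
  by case: (f j); case: (g j); case: (j == i).
by exists i; apply/setP => j; rewrite !inE ffunE; case: (f j); case: (j == i).
Qed.

Section Main.

Variables (T : finType) (e : rel T) (b c : nat -> nat).
Hypotheses (e_simple : simple_graph e) (e_drg : distance_regular_with e b c).
Hypothesis D_ge4 : 3 < diameter e.

Local Notation d := (gdist e).
Local Notation D := (diameter e).

Let e_sym : symmetric e := e_simple.1.
Let e_irr : irreflexive e := e_simple.2.
Let e_conn : connected_graph e := e_drg.1.
Let D_gt1 : 1 < D := ltnW (ltnW D_ge4).
Let D_gt0 : 0 < D := ltnW D_gt1.

Lemma quadrangle_vertices : contains_quadrangle e ->
  exists p q r s, [/\ e p q, e q r, e r s & e s p] /\ d p r = 2 /\ d q s = 2.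
Proof.
move=> [h h_inj hE].
pose o i (lt_i4 : i < 4) := h (Ordinal lt_i4).
exists (@o 0 isT), (@o 1 isT), (@o 2 isT), (@o 3 isT).
have adj : [/\ e (@o 0 isT) (@o 1 isT), e (@o 1 isT) (@o 2 isT),
  e (@o 2 isT) (@o 3 isT) & e (@o 3 isT) (@o 0 isT)] by rewrite /o !hE.
split=> //; case: adj => pq qr rs sp.
have dist2 u v w : u != v -> ~~ e u v -> e u w -> e w v -> d u v = 2.
  move=> neq nadj uw wv; rewrite e_sym in wv.
  have := common_nbr_gdist e_simple e_drg uw wv.
  move: neq nadj; rewrite -(gdist_eq0 e_conn) -(gdist_eq1 e_irr e_conn); lia.
split.
  by apply: dist2 pq qr; rewrite ?(inj_eq h_inj) ?hE.
by apply: dist2 qr rs; rewrite ?(inj_eq h_inj) ?hE.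
Qed.

Lemma array_unique (b' c' : nat -> nat) : distance_regular_with e b' c' ->
  forall i, i <= D -> c i = c' i /\ b i = b' i.
Proof.
move=> drg' i iD; have [x [y dxy]] := ex_gdist e_irr e_conn D_gt0 iD.
by have [<- <-] := e_drg.2 _ _ _ iD dxy; have [<- <-] := drg'.2 _ _ _ iD dxy.
Qed.

(** [growth_sum] up to level [D - 2], combined with c_2 <= b_(D-2), b_1 <= k - 1 and c_(D-1) <= k -
    b_(D-1) <= k - 1. *)
Lemma few_triangles_bound : b 0 <= (b 1 + c 2).+1 -> 1 < c 2 ->
  D * c 2 + (D - 4) * (c 2 - 2) <= 2 * b 0.
Proof.
move=> a1_le c2_gt1.
have := @growth_sum _ _ _ _ e_simple e_drg D_gt1 a1_le c2_gt1 (D - 3) ltac:(lia).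
have := c2_le_b e_simple e_drg D_gt0 D_gt1.
have := c_plus_b_le e_simple e_drg D_gt0 D_gt0; rewrite (intersection_c1 e_simple e_drg D_gt0).
have := @c_plus_b_le _ _ _ _ e_simple e_drg D_gt0 D.-1 ltac:(lia).
have := @b_gt0 _ _ _ _ e_simple e_drg D_gt0 D.-1 ltac:(lia).
have [m ->] : exists m, D = m.+4 by exists (D - 4); lia.
rewrite !subSS !subn0 /=; case: (c 2) c2_gt1 => [//|[//|t]] _.
by rewrite subn2 /=; lia.
Qed.

Lemma few_triangles_equality : b 0 <= (b 1 + c 2).+1 -> 1 < c 2 ->
  D * c 2 = 2 * b 0 ->
  (D = 4 /\ hadamard_graph e) \/ (4 < D /\ graph_iso e (@cube_graph D)).
Proof.
move=> a1_le c2_gt1 eq_D; have le_D := few_triangles_bound a1_le c2_gt1.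
have c_b := c_plus_b_le e_simple e_drg D_gt0; have C1 := intersection_c1 e_simple e_drg D_gt0.
have b_incr := b_decr e_simple e_drg D_gt1 a1_le c2_gt1.
have c_incr := c_incr e_simple e_drg D_gt1 a1_le c2_gt1.
have b_pos := b_gt0 e_simple e_drg D_gt0.
have [D4|D_neq4] := eqVneq D 4; [left; split=> // | right].
- have grow := growth_sum e_simple e_drg D_gt1 a1_le c2_gt1.
  have b2 := c2_le_b e_simple e_drg D_gt0 D_gt1.
  have BD := intersection_bD e_simple e_drg D_gt0.
  have C0 := intersection_c0 e_simple e_drg D_gt0.
  rewrite D4 in eq_D b_pos c_incr c_b b2 BD grow; have {}b2 : c 2 <= b 2 := b2.
  (* Now k = 2 c_2, so 4 c_2 - 2 <= b_2 + c_2 + 2 (c_2 - 1) <= b_1 + c_3 <= 2 (k - 1) is an equality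
     throughout, which fixes the array. *)
  have := grow 1 isT; have := b_pos 3 isT; have := c_incr 2 isT.
  have := c_b 1 isT; have := c_b 3 isT; have := c_b 4 isT.
  rewrite C1 => *.
  have arr : [/\ b 1 = (b 0).-1, b 2 = (b 0)./2, b 3 = 1
                & [/\ c 2 = (b 0)./2, c 3 = (b 0).-1 & c 4 = b 0]].
    by split; [lia|lia|lia|split; lia].
  exists (b 0); first by lia.
  split; [by rewrite D4 | by rewrite D4 | split=> //].
  have [B1 B2 B3 [C2 C3 C4]] := arr.
  move=> i x y le_i dxy; have [-> ->] := e_drg.2 _ _ _ le_i dxy.
  by move: le_i; rewrite D4; case: i dxy => [|[|[|[|[|//]]]]] _ _; split.
- have D_gt4 : 4 < D by lia.
  split=> //; have c2E : c 2 = 2.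
    have : (D - 4) * (c 2 - 2) == 0 by rewrite -leqn0 -(leq_add2l (2 * b 0)) addn0 -{1}eq_D.
    by rewrite muln_eq0; lia.
  have b0E : b 0 = D by lia.
  (* Strict monotonicity gives c_i >= i and b_i >= D - i; since c_i + b_i <= k = D, both are
     equalities. *)
  have c_ge i : i < D -> i.+1 <= c i.+1.
    by elim: i => [|i IHi] iD; [rewrite C1 | have := IHi (ltnW iD); have := c_incr _ iD; lia].
  have b_ge m i : i + m.+1 = D -> m.+1 <= b i.
    elim: m i => [|m IHm] i im; first by apply: b_pos; lia.
    by have := IHm i.+1 ltac:(lia); have := b_incr i ltac:(lia); lia.
  have c_ge' i : i <= D -> i <= c i by case: i => // i; apply: c_ge.
  have b_ge' i : i <= D -> D - i <= b i.
    by case def_m: (D - i) => [//|m] iD; apply: b_ge; lia.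
  apply: (iso_cube e_simple e_drg D_gt1) => i iD.
    case: i iD => [|i] iD; first exact: intersection_c0 e_simple e_drg D_gt0.
    by have := c_ge i iD; have := c_b _ iD; have := b_ge' _ iD; lia.
  by have := b_ge' _ iD; have := c_b _ iD; have := c_ge' _ iD; lia.
Qed.
Lemma c2_gt1_of_quadrangle : contains_quadrangle e -> 1 < c 2.
Proof.
move=> /quadrangle_vertices[p [q [r [s [[pq qr rs sp] [dpr dqs]]]]]].
rewrite -(card_common_gdist2 e_simple e_drg dpr).
have neq_qs : q != s by rewrite -(gdist_eq0 e_conn) dqs.
have <- : #|[set q; s]| = 2 by rewrite cards2 neq_qs.
apply/subset_leq_card/subsetP => z; rewrite !inE => /orP[] /eqP ->.
  by rewrite pq e_sym qr.
by rewrite e_sym sp rs.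
Qed.

Lemma c2_bound : contains_quadrangle e -> D * c 2 <= 2 * b 0.
Proof.
move=> quad; have c2_gt1 := c2_gt1_of_quadrangle quad.
have [a1_le|a1_gt] := leqP (b 0) (b 1 + c 2).+1.
  by apply: leq_trans (few_triangles_bound a1_le c2_gt1); rewrite leq_addr.
have [p [q [r [s [[pq qr rs sp] [dpr dqs]]]]]] := quadrangle_vertices quad.
apply: leq_trans (terwilliger_bound e_simple e_drg D_gt1 pq qr rs sp dpr dqs).
by rewrite leq_mul2l; lia.
Qed.

Lemma c2_equality : contains_quadrangle e -> D * c 2 = 2 * b 0 ->
  (D = 4 /\ hadamard_graph e) \/ (4 < D /\ graph_iso e (@cube_graph D)).
Proof.
move=> quad eq_D; have c2_gt1 := c2_gt1_of_quadrangle quad.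
have [a1_le|a1_gt] := leqP (b 0) (b 1 + c 2).+1; first exact: few_triangles_equality.
have [p [q [r [s [[pq qr rs sp] [dpr dqs]]]]]] := quadrangle_vertices quad.
(* Here a_1 + 2 > c_2, so the bound D (a_1 + 2) <= 2 k = D c_2 is contradictory. *)
have := terwilliger_bound e_simple e_drg D_gt1 pq qr rs sp dpr dqs.
by rewrite -eq_D leq_pmul2l //; lia.
Qed.

Lemma cube_valency : graph_iso e (@cube_graph D) -> b 0 = D.
Proof.
move=> [h [g hK gK] hE]; have [x _] := diameter_witness D_gt0.
rewrite -(card_nbrs e_simple e_drg x) -[RHS](card_cube_nbrs (h x)).
rewrite -(card_imset _ (can_inj hK)); apply: eq_card => z.
apply/imsetP/idP => [[y xy ->]|hz]; first by move: xy; rewrite !inE hE.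
by exists (g z); rewrite ?gK // inE -hE gK; rewrite inE in hz.
Qed.

End Main.

Import Order.TTheory GRing.Theory Num.Theory.
Local Open Scope ring_scope.

Theorem theorem1 (T : finType) (e : rel T) (b c : nat -> nat) (k D : nat)
    (simple_e : simple_graph e)
    (drg_e : distance_regular_with e b c)
    (valency_e : b 0%N = k)
    (diameter_e : diameter e = D)
    (D_ge4 : (4 <= D)%N)
    (quad_e : contains_quadrangle e) :
  ((c 2%N)%:R : rat) <= 2 / D%:R * k%:R /\
  (((c 2%N)%:R : rat) = 2 / D%:R * k%:R <->
     (D = 4%N /\ hadamard_graph e) \/
     ((5 <= D)%N /\ graph_iso e (@cube_graph D))).
Proof.
subst k D; set D := diameter e in D_ge4 *.
have D_gt0 : 0 < D%:R :> rat by rewrite ltr0n; lia.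
have le_c2 := c2_bound simple_e drg_e D_ge4 quad_e.
have ratE : 2 / D%:R * (b 0)%:R = (2 * b 0)%:R / D%:R :> rat by rewrite natrM mulrAC.
have eqE : ((c 2)%:R = 2 / D%:R * (b 0)%:R :> rat) <-> (D * c 2 = 2 * b 0)%N.
  rewrite ratE; split=> [c2E|eq_D].
    by apply/eqP; rewrite -(eqr_nat rat) natrM c2E mulrCA divff ?mulr1 // gt_eqF.
  by rewrite -eq_D natrM mulrAC divff ?mul1r // gt_eqF.
split; first by rewrite ratE ler_pdivlMr // -natrM mulnC ler_nat.
rewrite eqE; split; first exact: c2_equality.
move=> [[D4 [k k_even [_ _ drg']]]|[D_gt4 iso]].
  have arr := array_unique simple_e drg_e D_ge4 drg'.
  have [_ ->] := arr 0%N isT; have [|-> _] := arr 2%N; first by rewrite -/D D4.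
  by rewrite /= D4; lia.
(* Only the valency of the cube is needed: with k = D the bound gives c_2 <= 2, and the quadrangle
   gives c_2 >= 2. *)
have b0E := cube_valency simple_e drg_e D_ge4 iso.
have := c2_gt1_of_quadrangle simple_e drg_e D_ge4 quad_e.
by move: le_c2; rewrite b0E -/D mulnC leq_pmul2r; nia.
Qed.
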